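(* If $f\in\mathcal P$ is not a constant series, then the map $f:C\to C$ is surjective and open.
   Context: Let $p$ be a prime and $C$ an algebraically closed field of characteristic $p$ complete with respect to a non-archimedean absolute value $|\cdot|$. Let $E=\{mp^n: m,n\in\mathbb Z,\ m\ge0\}$; for $z\in C$ and $e=mp^n\in E$, $z^e$ means $(z^{1/p^n})^m$ using unique $p$-power roots in $C$. Let $\mathcal P$ be the set of series $f=\sum_{e\in E}a_ez^e$ with $a_e\in C$ which converge at every $z\in C$ (i.e. for each $z\in C$ and $r>0$ only finitely many terms have absolute value greater than $r$); each defines a function $C\to C$. A series is constant if $a_e=0$ for all $e\neq0$.
   Formalization: For e = mp^n, z^e is taken to be (z^{p^n})^m (a unique p-power root when n<0), not (z^{1/p^n})^m, which would depend on the choice of (m,n): 1 = 1·p^0 = p·p^{-1} would give both z and z^{p^2}. *)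

(* Defs.v *)
From HB Require Import structures.
From mathcomp Require Import all_boot all_order all_algebra finmap zify.
From mathcomp Require Import all_classical all_reals all_analysis.
From mathcomp Require Import summability.

Set Implicit Arguments.
Unset Strict Implicit.
Unset Printing Implicit Defensive.

Import Order.TTheory GRing.Theory Num.Theory.

Local Open Scope classical_set_scope.
Local Open Scope ring_scope.

(* The trivial absolute value is allowed. *)
Record nonarchAbs (R : realType) (C : fieldType) := NonarchAbs {
  nabs :> C -> R;
  nabs_ge0 : forall x, 0 <= nabs x;
  nabs_eq0 : forall x, nabs x = 0 <-> x = 0;
  nabsM : forall x y, nabs (x * y) = nabs x * nabs y;
  nabsD_max : forall x y, nabs (x + y) <= Num.max (nabs x) (nabs y)
}.

Section NonarchAbsTheory.
Context (R : realType) (C : fieldType) (v : nonarchAbs R C).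
Implicit Types x y : C.

Lemma nabs0 : v 0 = 0.
Proof. by apply/nabs_eq0. Qed.

Lemma nabs1 : v 1 = 1.
Proof.
have n0 : v 1 != 0 by apply/eqP => /nabs_eq0/eqP; rewrite oner_eq0.
by apply: (mulfI n0); rewrite -nabsM !mulr1.
Qed.

Lemma nabsN x : v (- x) = v x.
Proof.
suff vN1 : v (-1) = 1 by rewrite -mulN1r nabsM vN1 mul1r.
apply/eqP; rewrite -(@eqrXn2 _ 2) ?nabs_ge0// expr1n expr2 -nabsM.
by rewrite mulrNN mulr1 nabs1.
Qed.

Lemma nabs_distC x y : v (x - y) = v (y - x).
Proof. by rewrite -nabsN opprB. Qed.

End NonarchAbsTheory.

(* The field C carrying the metric topology of the absolute value v. *)
Definition valued (R : realType) (C : closedFieldType) (v : nonarchAbs R C) :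
  Type := C.

Section ValuedTopology.
Context (R : realType) (C : closedFieldType) (v : nonarchAbs R C).
Local Notation T := (valued v).

HB.instance Definition _ := GRing.ClosedField.copy T C.
HB.instance Definition _ := isPointed.Build T 0.

Definition valued_ball (x : T) (r : R) (y : T) : Prop := v (x - y) < r.

Let ball_center (x : T) (r : R) : 0 < r -> valued_ball x r x.
Proof. by rewrite /valued_ball subrr nabs0. Qed.

Let ball_sym (x y : T) (r : R) : valued_ball x r y -> valued_ball y r x.
Proof. by rewrite /valued_ball nabs_distC. Qed.

Let ball_triangle (x y z : T) (r s : R) :
  valued_ball x r y -> valued_ball y s z -> valued_ball x (r + s) z.
Proof.
rewrite /valued_ball => xy yz.
rewrite (le_lt_trans (y := v (x - y) + v (y - z))) ?ltrD//.
have -> : x - z = (x - y) + (y - z) by rewrite addrA subrK.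
apply: le_trans (nabsD_max v _ _) _.
by rewrite ge_max lerDl lerDr !nabs_ge0.
Qed.

HB.instance Definition _ :=
  hasNbhs.Build T (nbhs_ (entourage_ valued_ball)).

HB.instance Definition _ := @Nbhs_isPseudoMetric.Build R T
  (entourage_ valued_ball) erefl valued_ball
  ball_center ball_sym ball_triangle erefl.

End ValuedTopology.

Definition complete_abs (R : realType) (C : closedFieldType)
    (v : nonarchAbs R C) : Prop :=
  forall F : set_system (valued v), ProperFilter F -> cauchy F -> cvg F.

Definition expset (p : nat) : set rat :=
  [set e | exists (m : nat) (n : int), e = m%:R * p%:R ^ n].

Section Powers.
Context (C : fieldType) (p : nat).

(* z^(p^n). For n < 0 a p^(-n)-th root is picked; it is unique in
   characteristic p. *)
Definition frobz (z : C) (n : int) : C :=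
  match n with
  | Posz k => z ^+ (p ^ k)
  | Negz k => xget 0 [set w | w ^+ (p ^ k.+1) = z]
  end.

(* The value does not depend on the choice of m and n, see powEE. *)
Definition powE (z : C) (e : expset p) : C :=
  xget 0 [set y | exists (m : nat) (n : int),
                    \val e = m%:R * p%:R ^ n /\ y = frobz z n ^+ m].

End Powers.

Lemma frobzE (C : closedFieldType) (p : nat) (z : C) (n : int) (N k : nat) :
  p \in [pchar C] -> k%:Z = N%:Z + n ->
  frobz p z n ^+ (p ^ N) = z ^+ (p ^ k).
Proof.
move=> pC; have p0 := prime_gt0 (pcharf_prime pC).
case: n => n /= kE.
  have -> : k = (n + N)%N by case: kE; rewrite addnC.
  by rewrite -exprM expnD.
have NE : N = (n.+1 + k)%N by lia.
have [w wE] : exists w : C, w ^+ (p ^ n.+1) = z.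
  have [|w] := @solve_monicpoly C (p ^ n.+1)%N (fun i => if i == 0%N then z else 0).
    by rewrite expn_gt0 p0.
  have : (0 < p ^ n.+1)%N by rewrite expn_gt0 p0.
  case: (p ^ n.+1)%N => // q _ wE; exists w.
  by rewrite wE big_ord_recl/= expr0 mulr1 big1 ?addr0// => i _; rewrite mul0r.
by rewrite NE expnD exprM (@xgetPex _ 0 [set w | w ^+ (p ^ n.+1) = z])//; exists w.
Qed.

Lemma pchar_expn_inj (C : fieldType) (p N : nat) :
  p \in [pchar C] -> injective (fun x : C => x ^+ (p ^ N)).
Proof.
move=> pC x y /= /eqP; rewrite -subr_eq0 => xy; apply/eqP; rewrite -subr_eq0.
have pN : p.-nat (p ^ N)%N by rewrite pnatX pnat_id ?(pcharf_prime pC).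
have pNC : [pchar C].-nat (p ^ N)%N by rewrite (eq_pnat _ (pcharf_eq pC)).
move: xy; rewrite -exprNn_pchar// -exprDn_pchar//.
by rewrite expf_eq0 => /andP[].
Qed.

Lemma powEE (C : closedFieldType) (p : nat) (z : C) (e : expset p) (m : nat)
    (n : int) :
  p \in [pchar C] -> \val e = m%:R * p%:R ^ n -> powE z e = frobz p z n ^+ m.
Proof.
move=> pC eE; have p0 := prime_gt0 (pcharf_prime pC).
apply: xget_unique => /=; first by exists m, n.
move=> _ [m' [n' [eE' ->]]].
pose N := (`|n| + `|n'|)%N.
have [k kE] : exists k : nat, k%:Z = N%:Z + n.
  by exists (absz (N%:Z + n)); rewrite /N; lia.
have [k' kE'] : exists k : nat, k%:Z = N%:Z + n'.
  by exists (absz (N%:Z + n')); rewrite /N; lia.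
have pQ0 : (p%:R : rat) != 0 by rewrite pnatr_eq0 -lt0n.
have E : (p ^ k' * m' = p ^ k * m)%N.
  apply/eqP; rewrite -(eqr_nat rat) !natrM !natrX.
  rewrite -[_ ^+ k']/(_ ^ k'%:Z) -[_ ^+ k]/(_ ^ k%:Z) kE kE' !expfzDr//.
  by rewrite -!mulrA ![_ ^ _ * _%:R]mulrC -eE -eE'.
apply: (pchar_expn_inj (N := N) pC) => /=.
by rewrite -![_ ^+ _ ^+ (p ^ N)]exprAC (frobzE z pC kE) (frobzE z pC kE') -!exprM E.
Qed.

Section Series.
Context (R : realType) (C : closedFieldType) (v : nonarchAbs R C) (p : nat).
Implicit Type a : expset p -> C.

Definition series_term a (z : C) (e : expset p) : C := a e * powE z e.

Definition entire_series a : Prop :=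
  forall (z : C) (r : R), 0 < r ->
    finite_set [set e : expset p | r < v (series_term a z e)].

Definition constant_series a : Prop :=
  forall e : expset p, \val e <> 0 -> a e = 0.

(* Unordered sum: the limit, for the topology of v, of the sums over finite
   sets of exponents. *)
Definition series_fun a (z : valued v) : valued v :=
  lim (partial_sum (series_term a z : expset p -> valued v) @ totally).

End Series.

Arguments entire_series {R C} v {p} a.
Arguments series_fun {R C} v {p} a z.

Definition open_map (X Y : topologicalType) (f : X -> Y) : Prop :=
  forall U : set X, open U -> open (f @` U).

(* Main.v *)
Require Import Defs.
From HB Require Import structures.
From mathcomp Require Import all_boot all_order all_algebra finmap.
From mathcomp Require Import all_classical all_reals all_analysis.
From mathcomp Require Import summability zify ring lra.

(* A truncation of f is P(z^(1/p^N)) for a polynomial P, and z |-> z^(p^N) is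
   additive in characteristic p, so distances between points and between their
   p^N-th roots determine each other.  On a disc |z| <= |z0|, let M > 0 be an
   exponent whose term strictly dominates at z0 all terms of larger exponent.
   If |f(z) - w| <= |a_M| r^M, then the truncations of f - w have a root within
   distance r of z, with an estimate independent of N.  Iterating with radii
   tending to 0 and using completeness yields an exact solution of f(z') = w
   with |z' - z| <= r.  Taking r = |z0| large gives surjectivity, and letting r
   be small gives openness. *)

Set Implicit Arguments.
Unset Strict Implicit.
Unset Printing Implicit Defensive.

Import Order.TTheory GRing.Theory Num.Theory.

Local Open Scope classical_set_scope.
Local Open Scope ring_scope.

(** * Polynomials over a non-archimedean field: locating roots *)

Section NonarchPoly.
Context (R : realType) (C : closedFieldType) (v : nonarchAbs R C).
Implicit Types (x y z : C) (P Q : {poly C}) (c r : R).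

Lemma nabsX x n : v (x ^+ n) = v x ^+ n.
Proof. by elim: n => [|n IH]; rewrite ?expr0 ?nabs1// !exprS nabsM IH. Qed.

Lemma nabs_gt0 x : (0 < v x) = (x != 0).
Proof.
rewrite lt_def nabs_ge0 andbT; congr (~~ _).
by apply/eqP/eqP => [/nabs_eq0//|->]; rewrite nabs0.
Qed.

Lemma nabsD_le x y c : v x <= c -> v y <= c -> v (x + y) <= c.
Proof. by move=> xc yc; rewrite (le_trans (nabsD_max v x y))// ge_max xc yc. Qed.

Lemma nabs_dist_le y x z c : v (x - y) <= c -> v (y - z) <= c -> v (x - z) <= c.
Proof. by move=> xy yz; rewrite -(subrKA y); apply: nabsD_le. Qed.

Lemma nabsD_lt x y c : v x < c -> v y < c -> v (x + y) < c.
Proof.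
by move=> xc yc; rewrite (le_lt_trans (nabsD_max v x y))// gt_max xc yc.
Qed.

Lemma nabsMn_le x n : v (x *+ n) <= v x.
Proof.
elim: n => [|n IH]; first by rewrite mulr0n nabs0 nabs_ge0.
by rewrite mulrS; apply: nabsD_le.
Qed.

Lemma nabs_sum_le (I : Type) (s : seq I) (D : pred I) (F : I -> C) c :
  0 <= c -> (forall i, D i -> v (F i) <= c) -> v (\sum_(i <- s | D i) F i) <= c.
Proof.
move=> c0 Fc; apply: (big_ind (fun x => v x <= c)) => //.
  by rewrite nabs0.
by move=> x y; apply: nabsD_le.
Qed.

Lemma nabs_sum_lt (I : Type) (s : seq I) (D : pred I) (F : I -> C) c :
  0 < c -> (forall i, D i -> v (F i) < c) -> v (\sum_(i <- s | D i) F i) < c.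
Proof.
move=> c0 Fc; apply: (big_ind (fun x => v x < c)) => //.
  by rewrite nabs0.
by move=> x y; apply: nabsD_lt.
Qed.

Lemma nabsD_eq x y : v y < v x -> v (x + y) = v x.
Proof.
move=> yx; apply/le_anti/andP; split; first exact: nabsD_le (ltW yx).
rewrite leNgt; apply/negP => xyx.
by have := nabsD_lt xyx (y := - y); rewrite nabsN addrK => /(_ yx); rewrite ltxx.
Qed.

(** Up to sign, the constant coefficient is the product of all roots, and the coefficient of degree
    k is a sum of products omitting k roots, each larger than [r] in absolute value. *)
Lemma coef_prod_XsubC_lt (s : seq C) r : 0 <= r ->
  (forall u, u \in s -> r < v u) ->
  let Q := \prod_(u <- s) ('X - u%:P) in
  0 < v Q`_0 /\ forall i, v Q`_i.+1 * r ^+ i.+1 < v Q`_0.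
Proof.
move=> r0; elim: s => [|u s IH] su /=.
  rewrite big_nil coef1 nabs1; split=> // i.
  by rewrite coef1/= nabs0 mul0r.
have ru : r < v u by apply: su; rewrite mem_head.
have u0 : 0 < v u by apply: le_lt_trans ru.
have [|Q0 Qi] := IH; first by move=> x xs; apply: su; rewrite in_cons xs orbT.
rewrite big_cons; set Q := \prod_(_ <- s) _ in Q0 Qi *.
have cE i : (('X - u%:P) * Q)`_i = (if i is j.+1 then Q`_j else 0) - u * Q`_i.
  by rewrite mulrBl coefB coefXM coefCM; case: i.
rewrite cE sub0r nabsN nabsM; split=> [|i]; first by rewrite mulr_gt0.
rewrite cE.
apply: le_lt_trans (ler_wpM2r _ (nabsD_max v _ _)) _; first exact: exprn_ge0.
rewrite nabsN nabsM maxr_pMl ?exprn_ge0// gt_max -mulrA ltr_pM2l// Qi andbT.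
rewrite exprS mulrA mulrAC mulrC.
case: i => [|i]; first by rewrite expr0 mulr1 ltr_pM2r.
apply: le_lt_trans (_ : r * v Q`_0 < _); last by rewrite ltr_pM2r.
by rewrite ler_wpM2l// ltW.
Qed.

(* The m-th coefficient of the expansion of P at y has the absolute value of
   P`_m, because m is the largest dominant index at the radius |y|.  If all
   roots of P were at distance > r from y, then the constant term P(y) of this
   expansion would strictly dominate its m-th term at radius r. *)
Lemma close_root P (m : nat) y r : 0 <= r ->
  (forall i, (m < i)%N -> v P`_i * v y ^+ (i - m) < v P`_m) ->
  (0 < m)%N -> P`_m != 0 -> v P.[y] <= v P`_m * r ^+ m ->
  exists2 x, root P x & v (x - y) <= r.
Proof.
move=> r0 dom m0 Pm0 Py.
have [s PE] := closed_field_poly_normal P.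
have P0 : P != 0 by apply: contra_neq Pm0 => ->; rewrite coef0.
have l0 : lead_coef P != 0 by rewrite lead_coef_eq0.
have Ps x : root P x = (x \in s).
  by rewrite PE rootZ// root_prod_XsubC.
apply: contrapT => noroot.
have far u : u \in [seq x - y | x <- s] -> r < v u.
  move=> /mapP[x xs ->]; rewrite ltNge; apply/negP => xr.
  by apply: noroot; exists x => //; rewrite Ps.
have [Q0 Qi] := coef_prod_XsubC_lt r0 far.
rewrite big_map in Q0 Qi.
set Q := \prod_(x <- s) _ in Q0 Qi.
have PQ : P \Po ('X + y%:P) = lead_coef P *: Q.
  rewrite {1}PE linearZ/= rmorph_prod/=; congr (_ *: _).
  apply: eq_bigr => x _; rewrite comp_polyB comp_polyX comp_polyC.
  by rewrite polyCB opprB addrA.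
have Q0E : lead_coef P * Q`_0 = P.[y].
  by rewrite -coefZ -PQ -horner_coef0 horner_comp !hornerE.
have QmE : lead_coef P * Q`_m = P^`N(m).[y].
  rewrite -coefZ -PQ.
  have -> : P \Po ('X + y%:P) = \poly_(i < size P) P^`N(i).[y].
    rewrite addrC poly_def /comp_poly.
    rewrite (@nderiv_taylor _ _ y%:P 'X); last exact: mulrC.
    rewrite size_map_polyC; apply: eq_bigr => i _.
    by rewrite nderivn_map horner_map mul_polyC.
  rewrite coef_poly; case: ltnP => // le.
  by rewrite nderivn_poly0// horner0.
(* The terms are 'C(m + i, m) P_(m+i) y^i. Integers have absolute value at most 1 and 'C(m, m) = 1,
   so by [dom] the term i = 0 wins. *)
have vQm : v (P^`N(m).[y]) = v P`_m.
  rewrite horner_coef.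
  case sE: (size P^`N(m)) => [|n].
    move/eqP: sE; rewrite size_poly_eq0 => /eqP sE.
    have := coef_nderivn m P 0; rewrite sE coef0 addn0 binn mulr1n => E.
    by rewrite -E eqxx in Pm0.
  rewrite big_ord_recl expr0 mulr1 coef_nderivn addn0 binn mulr1n nabsD_eq//.
  apply: nabs_sum_lt; first by rewrite nabs_gt0.
  move=> i _; rewrite nabsM nabsX coef_nderivn.
  have dm : (m < m + lift ord0 i)%N by rewrite -[ltnLHS]addn0 ltn_add2l.
  have := dom _ dm; rewrite addKn; apply: le_lt_trans.
  by rewrite ler_wpM2r ?exprn_ge0 ?nabs_ge0// nabsMn_le.
have := Qi m.-1; rewrite prednK// -(ltr_pM2l (_ : 0 < v (lead_coef P))) ?nabs_gt0//.
by rewrite mulrA -!nabsM Q0E QmE vQm ltNge Py.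
Qed.

Lemma horner_lipschitz P c : 0 <= c -> exists2 L, 0 < L &
  forall x y, v x <= c -> v y <= c -> v (P.[x] - P.[y]) <= L * v (x - y).
Proof.
(* The induction also needs a bound [B] for P on the disc, because of the product rule for
   differences. *)
move=> c0; suff [L [B [L0 B0 LB]]] : exists L B, [/\ 0 < L, 0 <= B &
    forall x y, v x <= c -> v y <= c ->
    v P.[y] <= B /\ v (P.[x] - P.[y]) <= L * v (x - y)].
  by exists L => // x y xc yc; have [] := LB x y xc yc.
elim/poly_ind: P => [|P b [L [B [L0 B0 IH]]]].
  exists 1, 0; split=> // x y _ _.
  by rewrite !horner0 subr0 nabs0 mul1r nabs_ge0.
exists (L * c + B + 1), (B * c + v b); split.
- by rewrite ltr_wpDl// addr_ge0// mulr_ge0// ltW.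
- by rewrite addr_ge0 ?mulr_ge0// nabs_ge0.
move=> x y xc yc; have [Py Pxy] := IH x y xc yc.
rewrite !hornerMXaddC; split.
  apply: nabsD_le; last by rewrite lerDr mulr_ge0.
  by rewrite nabsM (le_trans (ler_pM _ _ Py yc)) ?nabs_ge0// lerDl nabs_ge0.
have -> : P.[x] * x + b - (P.[y] * y + b) =
    (P.[x] - P.[y]) * x + P.[y] * (x - y) by ring.
have d0 := nabs_ge0 v (x - y).
apply: nabsD_le; rewrite nabsM 2!mulrDl.
  apply: (le_trans (ler_pM _ _ Pxy xc)); rewrite ?nabs_ge0//.
  by rewrite mulrAC -addrA lerDl addr_ge0// mulr_ge0.
apply: (le_trans (ler_wpM2r d0 Py)).
by rewrite addrAC lerDr addr_ge0 ?mulr_ge0// ltW.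
Qed.

End NonarchPoly.

(** * Fractional powers as ordinary powers of a p^N-th root *)

Section Exponents.
Context (R : realType) (C : closedFieldType) (v : nonarchAbs R C) (p : nat).
Hypothesis pC : p \in [pchar C].
Implicit Types (e : expset p) (z : C).

Let p_gt0 : (0 < p)%N.
Proof. exact: prime_gt0 (pcharf_prime pC). Qed.

Let pQ0 : (p%:R : rat) != 0.
Proof. by rewrite pnatr_eq0 -lt0n. Qed.

Lemma expset_ge0 e : 0 <= \val e.
Proof.
by have [m [n ->]] := set_valP e; rewrite mulr_ge0 ?exprz_ge0 ?ler0n.
Qed.

(** Allowing every large [N] lets finitely many exponents share one denominator. *)
Lemma expset_denominator e : exists N0, forall N, (N0 <= N)%N ->
  exists m : nat, \val e * p%:R ^+ N = m%:R.
Proof.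
have [m [n ->]] := set_valP e; exists `|n|%N => N nN.
exists (m * p ^ absz (n + N%:Z)%R)%N.
rewrite -mulrA -[_ ^+ N]/(_ ^ N%:Z) -expfzDr// natrM natrX.
rewrite -[_ ^+ absz _]/(_ ^ (absz (n + N%:Z))%:Z); congr (_ * _ ^ _); lia.
Qed.

Lemma common_denominator (S : {fset expset p}) :
  exists N (m : expset p -> nat),
    forall e, e \in S -> \val e * p%:R ^+ N = (m e)%:R.
Proof.
have [N0 N0P] := choice expset_denominator.
exists (\max_(e <- enum_fset S) N0 e)%N.
have [e|m mP] := choice (_ : forall e, exists m : nat,
    e \in S -> \val e * p%:R ^+ (\max_(e <- enum_fset S) N0 e) = m%:R).
  have [eS|] := boolP (e \in S); last by exists 0%N.
  have [|m mE] := N0P e (\max_(e <- enum_fset S) N0 e)%N; last by exists m.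
  exact: leq_bigmax_seq.
by exists m.
Qed.

Lemma ex_frob_root N z : exists y, y ^+ (p ^ N) = z.
Proof.
exists (frobz p z (- N%:Z)).
by rewrite (@frobzE _ _ _ _ _ 0%N)// subrr.
Qed.

Lemma powE_frob (y : C) e N (m : nat) :
  \val e * p%:R ^+ N = m%:R -> powE (y ^+ (p ^ N)) e = y ^+ m.
Proof.
move=> eE; rewrite (powEE (m := m) (n := - N%:Z) _ pC).
  congr (_ ^+ m); apply: (pchar_expn_inj (N := N) pC) => /=.
  by rewrite (@frobzE _ _ _ _ _ 0%N)// subrr.
by rewrite -eE -invr_expz mulfK// expf_neq0.
Qed.

Lemma powR_frob e N (m : nat) (r : R) : 0 <= r ->
  \val e * p%:R ^+ N = m%:R -> (r ^+ (p ^ N)) `^ ratr (\val e) = r ^+ m.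
Proof.
move=> r0 eE; rewrite -powR_mulrn// -powRrM -powR_mulrn//; congr (_ `^ _).
rewrite -[m%:R](ratr_nat R) -eE rmorphM/= mulrC; congr (_ * _).
by rewrite -natrX ratr_nat.
Qed.

Lemma nabs_powE z e : v (powE z e) = v z `^ ratr (\val e).
Proof.
have [N /(_ N (leqnn N))[m eE]] := expset_denominator e.
have [y <-] := ex_frob_root N z.
by rewrite (powE_frob _ eE) !nabsX (powR_frob (nabs_ge0 v y) eE).
Qed.

Lemma nabs_powE_le z z' e : v z <= v z' -> v (powE z e) <= v (powE z' e).
Proof.
move=> zz'; rewrite !nabs_powE ge0_ler_powR// ?nnegrE ?nabs_ge0//.
by rewrite ler0q expset_ge0.
Qed.

End Exponents.

(** * Convergence of unordered sums *)

Section Sums.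
Context (R : realType) (C : closedFieldType) (v : nonarchAbs R C).
Context (I : choiceType) (F : I -> valued v).

Lemma partial_sumE (A : {fset I}) : partial_sum F A = \sum_(i <- A) F i.
Proof. by rewrite /partial_sum big_seq_fsetE. Qed.

Lemma nabs_partial_sumB (A B : {fset I}) (c : R) : 0 <= c ->
  (forall i, i \notin A -> v (F i) <= c) -> (A `<=` B)%fset ->
  v (partial_sum F B - partial_sum F A) <= c.
Proof.
move=> c0 Fc AB; rewrite !partial_sumE.
rewrite (bigID (mem A))/= -big_filter.
have /(perm_big _) -> : perm_eq [seq i <- B | i \in A] A.
  apply: uniq_perm; rewrite ?filter_uniq ?fset_uniq// => i.
  by rewrite mem_filter; case: (boolP (i \in A)) => //= /(fsubsetP AB).
by rewrite addrAC subrr add0r; apply: nabs_sum_le.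
Qed.

Hypothesis Cc : complete_abs v.
Hypothesis F0 : forall r : R, 0 < r -> finite_set [set i | r < v (F i)].

Lemma nabs_lim_partial_sum (A : {fset I}) (c : R) : 0 < c ->
  (forall i, i \notin A -> v (F i) <= c) ->
  v (lim (partial_sum F @ totally) - partial_sum F A) <= c.
Proof.
move=> c0 Fc.
have tF := @totally_filter I.
have cvgF : cvg (partial_sum F @ totally).
  apply: Cc; apply: cauchy_exP => e e0.
  (* Halving turns the non-strict tail bound into membership in an open ball. *)
  have e20 : 0 < e / 2 by rewrite divr_gt0.
  have /finite_fsetP[S SE] := F0 e20.
  exists (partial_sum F S); exists S => //= B SB.
  rewrite /ball/= /valued_ball nabs_distC.
  apply: le_lt_trans (nabs_partial_sumB (ltW e20) _ SB) _; last by lra.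
  move=> i iS; rewrite leNgt; apply/negP => ei.
  have : [set` S] i by rewrite -SE.
  by rewrite /= (negbTE iS).
have /cvg_ballP/(_ c c0) [B _ BP] := cvgF.
have := BP (A `|` B)%fset; rewrite /= fsubsetUr => /(_ isT).
rewrite /ball/= /valued_ball => /ltW h.
by apply: nabs_dist_le h _; apply: nabs_partial_sumB; rewrite ?fsubsetUl// ltW.
Qed.

End Sums.

(** * Truncations of an entire series *)

Section EntireSeries.
Context (R : realType) (C : closedFieldType) (v : nonarchAbs R C) (p : nat).
Context (a : expset p -> C).
Hypothesis pC : p \in [pchar C].
Hypothesis Cc : complete_abs v.
Hypothesis aE : entire_series v a.
Implicit Types (z w : C) (S : {fset expset p}) (N : nat).

Let psum z S : C := partial_sum (series_term a z : expset p -> valued v) S.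
Let f : C -> C := series_fun v a.

(** The size of each term is nondecreasing in |z|, so the exponents whose terms exceed [c] at [z0]
    serve the whole disc. *)
Lemma uniform_truncation z0 (c : R) : 0 < c -> exists S, forall S' z,
  (S `<=` S')%fset -> v z <= v z0 -> v (f z - psum z S') <= c.
Proof.
move=> c0; have /finite_fsetP[S SE] := aE z0 c0.
exists S => S' z SS' zz0; apply: nabs_lim_partial_sum => //; first exact: aE.
move=> e eS'; rewrite /series_term nabsM.
apply: le_trans (ler_wpM2l (nabs_ge0 v _) (nabs_powE_le pC e zz0)) _.
rewrite -nabsM leNgt; apply/negP => ce.
have : [set` S] e by rewrite -SE.
by move=> /= /(fsubsetP SS'); rewrite (negbTE eS').
Qed.

(** Substituting z = y^(p^N) clears denominators. Distinct exponents have distinct [m e], so no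
    coefficients merge; degree 0 is set apart since [w] changes it. *)
Lemma truncation_poly S w : exists N (m : expset p -> nat) (P : {poly C}),
  [/\ forall e, e \in S -> \val e * p%:R ^+ N = (m e)%:R,
      forall y, P.[y] = psum (y ^+ (p ^ N)) S - w,
      forall e, e \in S -> (0 < m e)%N -> P`_(m e) = a e &
      forall i, (0 < i)%N -> P`_i != 0 -> exists2 e, e \in S & i = m e].
Proof.
have [N [m mE]] := common_denominator pC S.
exists N, m, (\sum_(e <- S) a e *: 'X^(m e) - w%:P).
have pN0 : (p%:R : rat) ^+ N != 0.
  by rewrite expf_neq0// pnatr_eq0 -lt0n prime_gt0// (pcharf_prime pC).
have coefP i : (0 < i)%N ->
    (\sum_(e <- S) a e *: 'X^(m e) - w%:P)`_i =
    \sum_(e <- S) a e * (i == m e)%:R.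
  rewrite lt0n => /negbTE i0; rewrite coefB coefC i0 subr0 coef_sum.
  by apply: eq_bigr => e _; rewrite coefZ coefXn.
split=> //.
- move=> y; rewrite hornerD hornerN hornerC /psum partial_sumE horner_sum.
  congr (_ - _); rewrite big_seq [RHS]big_seq; apply: eq_bigr => e eS.
  by rewrite hornerZ hornerXn /series_term (powE_frob pC y (mE e eS)).
- move=> e eS me0; rewrite coefP// (big_rem e)//= eqxx mulr1 big_seq big1 ?addr0//.
  move=> e'; rewrite mem_rem_uniq ?fset_uniq// inE => /andP[e'e e'S].
  rewrite (_ : _ == _ = false) ?mulr0//; apply: contraNF e'e => /eqP mee'.
  by apply/eqP/val_inj/(mulIf pN0); rewrite !mE// mee'.
- move=> i i0; rewrite coefP// => nz; apply: contrapT => none; move: nz.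
  rewrite big_seq big1 ?eqxx// => e eS; case: eqP => ie; last by rewrite mulr0.
  by case: none; exists e.
Qed.

(** * Solving f(z) = w in the disc of radius |z0| *)

Context (z0 : C) (M : expset p).
Hypothesis z0_neq0 : z0 != 0.
Hypothesis M_gt0 : 0 < \val M.
Hypothesis aM_neq0 : a M != 0.
Hypothesis M_dom : forall e, \val M < \val e ->
  v (series_term a z0 e) < v (series_term a z0 M).

Let M' : R := ratr (\val M).

Lemma approx_solution z w (r eps : R) : 0 < r -> r <= v z0 -> 0 < eps ->
  v z <= v z0 -> v (f z - w) <= v (a M) * r `^ M' ->
  exists z', [/\ v (z' - z) <= r, v z' <= v z0 & v (f z' - w) <= eps].
Proof.
move=> r0 rz0 eps0 zz0 fzw.
have aMr0 : 0 < v (a M) * r `^ M' by rewrite mulr_gt0 ?powR_gt0 ?nabs_gt0.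
(* The truncation error must keep |P(y)| within |a_M| r^M' and be at most [eps] at the new point. *)
pose c := Num.min eps (v (a M) * r `^ M').
have c0 : 0 < c by rewrite lt_min eps0.
have [S0 S0P] := uniform_truncation z0 c0.
(* Adding [M] ensures that [P] has coefficient [a M] in degree [m M]. *)
pose S := (M |` S0)%fset.
have SP z1 : v z1 <= v z0 -> v (f z1 - psum z1 S) <= c.
  by apply: S0P; exact: fsubsetUr.
have MS : M \in S by rewrite !inE eqxx.
have [N [m [P [mE PE Pm Pi]]]] := truncation_poly S w.
have q0 : (0 < p ^ N)%N by rewrite expn_gt0 prime_gt0// (pcharf_prime pC).
have pN0 : 0 < (p%:R : rat) ^+ N.
  by rewrite exprn_gt0// ltr0n prime_gt0// (pcharf_prime pC).
have [y yE] := ex_frob_root pC N z; have [y0 y0E] := ex_frob_root pC N z0.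
have yy0 : v y <= v y0.
  by rewrite -(ler_pXn2r q0) ?nnegrE ?nabs_ge0// -!nabsX yE y0E.
have y00 : 0 < v y0.
  rewrite nabs_gt0; apply: contra_neq z0_neq0 => y0_0.
  by rewrite -y0E y0_0 expr0n gtn_eqF.
have mM0 : (0 < m M)%N by rewrite -(ltr0n rat) -mE// mulr_gt0.
(* A distance [s] between p^N-th roots is a distance [r] between points, and s^(m M) = r^M' does not
   depend on [N]. *)
pose s : R := r `^ (p ^ N)%:R^-1.
have sE : s ^+ (p ^ N) = r.
  rewrite -powR_mulrn ?powR_ge0// -powRrM mulVf ?powRr1 ?ltW//.
  by rewrite pnatr_eq0 -lt0n.
have sM : s ^+ m M = r `^ M'.
  by rewrite -sE /M' (powR_frob (powR_ge0 _ _) (mE M MS)).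
have [|||||x Px xy] := @close_root _ _ v P (m M) y s.
- exact: powR_ge0.
- move=> i mi; have i0 : (0 < i)%N by apply: leq_ltn_trans mi.
  rewrite Pm//; have [->|Pi0] := eqVneq P`_i 0.
    by rewrite nabs0 mul0r nabs_gt0.
  have [e eS iE] := Pi i i0 Pi0; rewrite iE Pm -?iE//.
  have Me : \val M < \val e by rewrite -(ltr_pM2r pN0) !mE// ltr_nat -iE.
  (* Written with [y0], dominance at [z0] can be divided by |y0|^(m M); |y| <= |y0| then carries it
     over to [y]. *)
  have := M_dom Me.
  rewrite /series_term -y0E !(powE_frob pC _ (mE _ _))// -iE !nabsM !nabsX.
  rewrite -{1}(subnK (ltnW mi)) exprD mulrA ltr_pM2r ?exprn_gt0//.
  apply: le_lt_trans; rewrite ler_wpM2l ?nabs_ge0//.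
  by rewrite lerXn2r ?nnegrE ?nabs_ge0.
- exact: mM0.
- by rewrite Pm.
- rewrite Pm// sM PE yE; apply: (nabs_dist_le (y := f z)) => //.
  by rewrite nabs_distC (le_trans (SP _ zz0))// ge_min lexx orbT.
have pN : [pchar C].-nat (p ^ N)%N.
  by rewrite (eq_pnat _ (pcharf_eq pC)) pnatX pnat_id ?(pcharf_prime pC).
have xz : v (x ^+ (p ^ N) - z) <= r.
  rewrite -yE -exprNn_pchar// -exprDn_pchar// nabsX -sE.
  by rewrite lerXn2r ?nnegrE ?nabs_ge0 ?powR_ge0.
have xz0 : v (x ^+ (p ^ N)) <= v z0.
  by rewrite -(subrK z (x ^+ _)) nabsD_le// (le_trans xz).
exists (x ^+ (p ^ N)); split=> //.
have := SP _ xz0; move/rootP: Px; rewrite PE => /subr0_eq ->.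
by move/le_trans; apply; rewrite ge_min lexx.
Qed.

(** A truncation is a polynomial in the p^N-th root, hence Lipschitz on the disc. This serves to
    pass to the limit in [solution]. *)
Lemma series_fun_continuous_disc z (eps : R) : 0 < eps -> v z <= v z0 ->
  exists2 d, 0 < d &
  forall z', v z' <= v z0 -> v (z' - z) < d -> v (f z' - f z) <= eps.
Proof.
move=> eps0 zz0.
have [S SP] := uniform_truncation z0 eps0.
have [N [m [P [mE PE Pm Pi]]]] := truncation_poly S 0.
have q0 : (0 < p ^ N)%N by rewrite expn_gt0 prime_gt0// (pcharf_prime pC).
have [y yE] := ex_frob_root pC N z; have [y0 y0E] := ex_frob_root pC N z0.
have bnd x : v (x ^+ (p ^ N)) <= v z0 -> v x <= v y0.
  by rewrite -y0E !nabsX ler_pXn2r ?nnegrE ?nabs_ge0.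
have [L L0 LP] := horner_lipschitz v P (nabs_ge0 v y0).
have pN : [pchar C].-nat (p ^ N)%N.
  by rewrite (eq_pnat _ (pcharf_eq pC)) pnatX pnat_id ?(pcharf_prime pC).
(* Since |z' - z| = |y' - y|^(p^N), this makes the roots closer than eps / L. *)
exists ((eps / L) ^+ (p ^ N)); first by rewrite exprn_gt0// divr_gt0.
move=> z' z'z0; have [y' y'E] := ex_frob_root pC N z'.
rewrite -{1}yE -{1}y'E -exprNn_pchar// -exprDn_pchar// nabsX.
rewrite ltr_pXn2r ?nnegrE ?nabs_ge0 ?(ltW (divr_gt0 eps0 L0))// => y'y.
apply: (nabs_dist_le (y := psum z S)); last first.
  by rewrite nabs_distC; apply: SP.
apply: (nabs_dist_le (y := psum z' S)); first exact: SP.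
have -> : psum z' S - psum z S = P.[y'] - P.[y] by rewrite !PE !subr0 yE y'E.
apply: (le_trans (LP _ _ _ _)); rewrite ?bnd ?yE ?y'E//.
by rewrite mulrC -ler_pdivlMr// ltW.
Qed.

Lemma solution z w (r : R) : 0 < r -> r <= v z0 ->
  v z <= v z0 -> v (f z - w) <= v (a M) * r `^ M' ->
  exists2 z', v (z' - z) <= r & f z' = w.
Proof.
move=> r0 rz0 zz0 fzw.
(* Radii decreasing from [r] to 0 suffice, without summability: a chain of steps moves no farther
   than its largest step. *)
pose rn n : R := r / n.+1%:R.
have rn0 n : 0 < rn n by rewrite divr_gt0.
have rn_le n k : (n <= k)%N -> rn k <= rn n.
  by move=> nk; rewrite ler_pM2l// lef_pV2 ?posrE// ler_nat ltnS.
have rn_small (eps : R) : 0 < eps -> exists n, rn n < eps.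
  move=> eps0; have e0 : 0 < eps / r by rewrite divr_gt0.
  have [n _ /(_ n (leqnn n))/= nP] := near_infty_natSinv_lt (PosNum e0).
  by exists n; rewrite /rn mulrC -ltr_pdivlMr.
have rnz0 n : rn n <= v z0.
  by apply: le_trans rz0; rewrite (le_trans (rn_le 0%N n _))// /rn divr1.
(* The pair holds the step number and the current point. The minimum makes the errors tend to 0 and
   provides the hypothesis of the next step. *)
have step_ex (x : nat * C) : exists z', v x.2 <= v z0 ->
    v (f x.2 - w) <= v (a M) * rn x.1 `^ M' ->
    [/\ v (z' - x.2) <= rn x.1, v z' <= v z0 &
        v (f z' - w) <= Num.min (rn x.1) (v (a M) * rn x.1.+1 `^ M')].
  have [h|h] := pselect (v x.2 <= v z0 /\ v (f x.2 - w) <= v (a M) * rn x.1 `^ M').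
    have [|z' z'P] := approx_solution (rn0 x.1) (rnz0 x.1)
        (eps := Num.min (rn x.1) (v (a M) * rn x.1.+1 `^ M')) _ h.1 h.2.
      by rewrite lt_min rn0 mulr_gt0 ?nabs_gt0 ?powR_gt0//; exact: rn0.
    by exists z'.
  (* A default value, never met by the iteration because of [uP]. *)
  by exists 0 => h1 h2; case: h.
have [g gP] := choice step_ex.
pose fix u n : C := if n is n'.+1 then g (n', u n') else z.
have uP n : v (u n) <= v z0 /\ v (f (u n) - w) <= v (a M) * rn n `^ M'.
  elim: n => [|n [IH1 IH2]]; first by rewrite /rn divr1.
  have [_ h1 h2] := gP (n, u n) IH1 IH2; split=> //.
  by apply: le_trans h2 _; rewrite ge_min lexx orbT.
have uS n : v (u n.+1 - u n) <= rn n /\ v (f (u n.+1) - w) <= rn n.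
  have [IH1 IH2] := uP n.
  have [h1 _ h2] := gP (n, u n) IH1 IH2; split=> //.
  by apply: le_trans h2 _; rewrite ge_min lexx.
have ud n k : v (u (n + k)%N - u n) <= rn n.
  elim: k => [|k IH]; first by rewrite addn0 subrr nabs0 ltW.
  apply: nabs_dist_le IH; rewrite addnS; have [h _] := uS (n + k)%N.
  by apply: le_trans h _; apply: rn_le; rewrite leq_addr.
have [l lP] : exists l : C, forall eps : R, 0 < eps ->
    exists n, forall k, (n <= k)%N -> v (l - u k) < eps.
  have /cvg_ex[/= l lP] : cvg ((u : nat -> valued v) @ \oo).
    apply: Cc; apply: cauchy_exP => eps eps0.
    have [n nP] := rn_small eps eps0.
    exists (u n); exists n => //= k nk.
    rewrite /ball/= /valued_ball nabs_distC (le_lt_trans _ nP)//.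
    by rewrite -(subnKC nk).
  exists l => eps eps0.
  by have /cvg_ballP/(_ eps eps0) [n _ nP] := lP; exists n => k /nP.
have lu n : v (l - u n) <= rn n.
  have [k kP] := lP _ (rn0 n).
  apply: (nabs_dist_le (y := u (n + k)%N)) => //.
  by apply/ltW/kP; rewrite leq_addl.
have lz : v (l - z) <= r by have := lu 0%N; rewrite /rn divr1.
have lz0 : v l <= v z0.
  by rewrite -(subrK z l) nabsD_le// (le_trans lz).
exists l => //; apply/eqP; rewrite -subr_eq0 -[_ == 0]negbK -(nabs_gt0 v).
apply/negP => fl.
have e0 : 0 < v (f l - w) / 2 by rewrite divr_gt0.
have [d d0 dP] := series_fun_continuous_disc e0 lz0.
have [k kP] := lP _ d0.
have [n nP] := rn_small _ e0.
have : v (f l - w) <= v (f l - w) / 2; last by lra.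
(* The index exceeds [k], so this point is near [l]; the value of f there is within rn (n + k) <= rn
   n of [w]. *)
apply: (nabs_dist_le (y := f (u (n + k).+1))).
  rewrite nabs_distC; apply: dP; first by have [] := uP (n + k).+1.
  by rewrite nabs_distC; apply: kP; rewrite ltnW// ltnS leq_addl.
have [_ h] := uS (n + k)%N; apply: le_trans h (le_trans _ (ltW nP)).
by apply: rn_le; rewrite leq_addr.
Qed.

End EntireSeries.

(** * Choosing the disc and the dominant exponent *)

Section DominantExponent.
Context (R : realType) (C : closedFieldType) (v : nonarchAbs R C) (p : nat).
Context (a : expset p -> C).
Hypothesis pC : p \in [pchar C].

(** Gives a term a prescribed size by solving an equation instead of scaling, which also covers the
    trivial absolute value. *)
Lemma powE_surj (e : expset p) (b : C) : 0 < \val e -> exists z, powE z e = b.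
Proof.
move=> e0; have [N /(_ N (leqnn N))[m eE]] := expset_denominator pC e.
have m0 : (0 < m)%N.
  rewrite -(ltr0n rat) -eE mulr_gt0// exprn_gt0// ltr0n.
  by rewrite prime_gt0// (pcharf_prime pC).
have /closed_rootP[x] : size ('X^m - b%:P) != 1%N.
  by rewrite size_XnsubC// -lt0n.
rewrite rootE !hornerE subr_eq0 => /eqP xm.
by exists (x ^+ (p ^ N)); rewrite (powE_frob pC x eE).
Qed.

(* M is the largest of the finitely many exponents e with
   |a_e z0^e| >= |a_e0 z0^e0|, where e0 > 0 is any exponent with a_e0 <> 0. *)
Lemma dominant_exponent (z b : C) :
  entire_series v a -> ~ constant_series a ->
  exists (z0 : C) (M : expset p), [/\ z0 != 0, v z <= v z0, 0 < \val M,
    a M != 0 & v b <= v (series_term a z0 M) /\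
    forall e, \val M < \val e -> v (series_term a z0 e) < v (series_term a z0 M)].
Proof.
move=> aE /existsNP[e0 /not_implyP[/eqP e0n0 /eqP ae0]].
have e0_gt0 : 0 < \val e0 by rewrite lt_def e0n0 (expset_ge0 e0).
(* At [y] the term of [e0] has absolute value |b|, so it has at least this size wherever |z| >=
   |y|. *)
have [y yE] := powE_surj (b / a e0) e0_gt0.
have max2 (x x' : C) : exists t, v x <= v t /\ v x' <= v t.
  by have [h|/ltW h] := leP (v x) (v x'); [exists x'|exists x].
(* Comparison with 1 makes [z0] nonzero. *)
have [t [zt yt]] := max2 z y; have [z0 [tz0 z01]] := max2 t 1.
have z0n0 : z0 != 0 by rewrite -(nabs_gt0 v) (lt_le_trans _ z01)// nabs1.
pose c := v (series_term a z0 e0).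
have bc : v b <= c.
  rewrite /c /series_term nabsM -[b](divfK ae0) mulrC nabsM ler_wpM2l ?nabs_ge0//.
  by rewrite -yE nabs_powE_le// (le_trans yt).
have c0 : 0 < c.
  rewrite /c /series_term nabsM mulr_gt0 ?nabs_gt0// -(nabs_gt0 v).
  by rewrite nabs_powE// powR_gt0 ?nabs_gt0.
(* Finiteness is given for strict inequalities; the level c / 2 also catches terms of size exactly
   [c]. *)
have c20 : 0 < c / 2 by rewrite divr_gt0.
have /finite_fsetP[S SE] := aE z0 _ c20.
have inS e : c <= v (series_term a z0 e) -> e \in S.
  move=> ce; have : [set` S] e; last by [].
  by rewrite -SE /=; lra.
have e0S := inS e0 (lexx c).
pose D := [pred e : S | c <= v (series_term a z0 (val e))].
have De0 : D [` e0S]%fset by rewrite /D/= lexx.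
case: (Order.TotalTheory.arg_maxP (fun e : S => \val (val e)) De0) => M DM Mmax.
exists z0, (val M).
have cM : c <= v (series_term a z0 (val M)) by exact: DM.
split=> //; first exact: le_trans tz0.
- exact: lt_le_trans e0_gt0 (Mmax _ De0).
- apply: contraTneq cM => aM; rewrite /series_term aM mul0r nabs0.
  by rewrite -ltNge.
split=> [|e Me]; first exact: le_trans cM.
apply: lt_le_trans cM; rewrite ltNge; apply/negP => ce.
by have := lt_le_trans Me (Mmax [` inS e ce]%fset ce); rewrite ltxx.
Qed.

End DominantExponent.

Theorem theorem5p1 (R : realType) (p : nat) (C : closedFieldType)
    (v : nonarchAbs R C) (a : expset p -> C) :
  prime p -> p \in [pchar C] -> complete_abs v ->
  entire_series v a -> ~ constant_series a ->
  set_surj [set: valued v] [set: valued v] (series_fun v a) /\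
  open_map (series_fun v a).
Proof.
move=> _ pC Cc aE anc; split.
  move=> w _ /=.
  (* With b = f(0) - w and r = |z0|, the term of [M] at [z0] has size |a_M| r^M', so 0 is an
     admissible starting point. *)
  have [z0 [M [z00 zz0 M0 aM [bM Mdom]]]] :=
    dominant_exponent pC 0 (series_fun v a 0 - w) aE anc.
  have [||z _ zw] := solution pC Cc aE z00 M0 aM Mdom
    (r := v z0) (z := 0) (w := w) _ (lexx _) zz0.
  - by rewrite nabs_gt0.
  - by move: bM; rewrite /series_term nabsM nabs_powE.
  by exists z.
move=> U; rewrite !openE => Uo _ [z /Uo/nbhs_ballP[r /= r0 rU] <-].
have [z0 [M [z00 zz0 M0 aM [_ Mdom]]]] := dominant_exponent pC z 0 aE anc.
(* The half fits the closed disc of radius [s] into the open ball of radius [r]; [v z0] keeps [s]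
   admissible for [solution]. *)
pose s := Num.min (r / 2) (v z0).
have s0 : 0 < s by rewrite lt_min divr_gt0//= nabs_gt0.
apply/nbhs_ballP; exists (v (a M) * s `^ ratr (\val M)).
  by rewrite /= mulr_gt0 ?powR_gt0 ?nabs_gt0.
move=> w /ltW zw.
have [|z' zz' z'w] := solution pC Cc aE z00 M0 aM Mdom s0 _ zz0 zw.
  by rewrite ge_min lexx orbT.
exists z' => //; apply: rU.
rewrite /ball/= /valued_ball nabs_distC (le_lt_trans zz')//.
by rewrite gt_min ltr_pdivrMr// mulr2n mulrDr mulr1 ltrDl r0.
Qed.
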